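(* Let $\mathcal{B}$ be a design over $\mathbb{F}_2$ with parameters $2$-$(v,k,\lambda_2)$, let $G\le GL_v(2)$ be an automorphism group of $\mathcal{B}$, and let $\Psi=\Psi_1\sqcup\cdots\sqcup\Psi_m$, $\mathcal{B}=\mathcal{B}_1\sqcup\cdots\sqcup\mathcal{B}_n$ be the tactical decomposition given by the $G$-orbits on points and on blocks, with tactical decomposition matrices $[\rho_{ij}]$, $[\kappa_{ij}]$. For $l,r,s\in\{1,\dots,m\}$ and a fixed point $P\in\Psi_l$ define $\sigma_{lrs}=|\{R\in\Psi_r\setminus\{P\}:P+R\in\Psi_s\}|$ (independent of the choice of $P\in\Psi_l$), and $$\phi^3_{rs}=\sum_{R\in\Psi_r}\ \sum_{\substack{S\in\Psi_s\\ \dim\langle P,R,S\rangle=3}} |\{B\in\mathcal{B}:\langle P,R,S\rangle\le B\}|.$$ Let $\lambda_1=\lambda_2\frac{2^{v-1}-1}{2^{k-1}-1}$ and $\varphi=\min\{\lambda_2,{v-3\brack k-3}_2\}$. Then $$\sum_{j=1}^n\rho_{lj}\kappa_{rj}\kappa_{sj}=\begin{cases}\sigma_{lrs}\lambda_2+\phi^3_{rs}, & l\ne r\ne s\ne l,\\ \lambda_1+(3|\Psi_l|+\sigma_{lrs}-3)\lambda_2+\phi^3_{rs}, & l=r=s,\\ (|\Psi_s|+\sigma_{lrs})\lambda_2+\phi^3_{rs}, & l=r\ne s\ \text{or}\ l\ne r=s,\end{cases}$$ and $$\phi^3_{rs}\le\begin{cases}(|\Psi_r|\,|\Psi_s|-\sigma_{lrs})\varphi,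 & l\ne r\ne s\ne l,\\ (|\Psi_l|^2-3|\Psi_l|-\sigma_{lrs}+2)\varphi, & l=r=s,\\ (|\Psi_r|\,|\Psi_s|-|\Psi_s|-\sigma_{lrs})\varphi, & l=r\ne s\ \text{or}\ l\ne r=s.\end{cases}$$
   Context: ${a\brack b}_2=\frac{(2^a-1)\cdots(2^{a-b+1}-1)}{(2^b-1)\cdots(2-1)}$ is the number of $b$-dimensional subspaces of $\mathbb{F}_2^a$. Points are the $1$-dimensional subspaces of $\mathbb{F}_2^v$; $\Psi$ is the set of all points. For distinct points $P,R$, $P+R$ is the third point of the $2$-space $\langle P,R\rangle$. A design over $\mathbb{F}_2$ with parameters $2$-$(v,k,\lambda_2)$ is a finite set $\mathcal{B}$ of $k$-dimensional subspaces (blocks) of $\mathbb{F}_2^v$ such that every $2$-dimensional subspace lies in exactly $\lambda_2$ blocks (so each point lies in exactly $\lambda_1$ blocks). An automorphism group is a subgroup $G\le GL_v(2)$ with $\Phi\mathcal{B}=\mathcal{B}$ for all $\Phi\in G$. The $G$-orbits on points and on blocks form a tactical decomposition: there are integers $\rho_{ij},\kappa_{ij}$ such that every point of $\Psi_i$ lies in exactly $\rho_{ij}$ blocks of $\mathcal{B}_j$, and every block of $\mathcal{B}_j$ contains exactly $\kappa_{ij}$ points of $\Psi_i$. The notation $l\ne r\ne s\ne l$ means $l,r,s$ pairwise distinct. *)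

(* Defs.v *)
From HB Require Import structures.
From mathcomp Require Import all_boot all_order all_algebra all_fingroup.
Set Implicit Arguments.
Unset Strict Implicit.
Unset Printing Implicit Defensive.
Import GRing.Theory.
Local Open Scope ring_scope.

Section FiniteVspace.

Import VectorInternalTheory.
Variables (K : finFieldType) (vT : vectType K).

HB.instance Definition _ := [Countable of {vspace vT} by <:].
HB.instance Definition _ := [Finite of {vspace vT} by <:].

End FiniteVspace.

(* The elements of {'GL_v(2)} are square matrices of size v.-1.+1, which is    *)
(* equal to v as soon as v > 0.                                                *)
Notation F2space v := 'rV['F_2]_v.-1.+1.

Section Geometry.

Variable v : nat.
Implicit Types (U P R Q : {vspace F2space v}) (g h : {'GL_v(2)}).

Definition is_point P := \dim P == 1%N.

Definition points : {set {vspace F2space v}} := [set P | is_point P].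

(* A point P over F_2 has exactly one nonzero vector, namely vpick P; see      *)
(* third_pointP below.                                                         *)
Definition third_point P R : {vspace F2space v} := <[vpick P + vpick R]>%VS.

Definition GLimage U g : {vspace F2space v} :=
  (linfun (mulmxr (GLval g)) @: U)%VS.

Fact GLimage1 : GLimage^~ 1%g =1 id.
Proof.
move=> U; rewrite /GLimage -[RHS]lim1g; congr (_ @: _)%VS.
by apply/lfunP => x; rewrite !lfunE /= mulmx1.
Qed.

Fact GLimageM U g h : GLimage U (g * h)%g = GLimage (GLimage U g) h.
Proof.
rewrite /GLimage -limg_comp; congr (_ @: _)%VS.
by apply/lfunP => x; rewrite comp_lfunE !lfunE /= mulmxA.
Qed.

Definition GLaction : {action {'GL_v(2)} &-> {vspace F2space v}} :=
  TotalAction GLimage1 GLimageM.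

Lemma pointE P : is_point P -> P = <[vpick P]>%VS.
Proof.
move=> /eqP dP; apply/esym/eqP.
rewrite eqEdim -memvE memv_pick dP dim_vline vpick0.
by rewrite -dimv_eq0 dP.
Qed.

Lemma third_pointP P R Q : is_point P -> is_point R -> P != R ->
  reflect [/\ is_point Q, (Q <= P + R)%VS, Q != P & Q != R]
          (Q == third_point P R).
Proof.
move=> pP pR; rewrite /third_point.
have xN0: vpick P != 0 by rewrite vpick0 -dimv_eq0 (eqP pP).
have yN0: vpick R != 0 by rewrite vpick0 -dimv_eq0 (eqP pR).
move: (pointE pP) (pointE pR) xN0 yN0.
move: (vpick P) (vpick R) => x y -> -> xN0 yN0 xyN.
have F2 (a : 'F_2) : a = 0 \/ a = 1.
  case: a => [[|[|a]] a2]; [left|right|by []]; exact: val_inj.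
have addxx (z : F2space v) : z + z = 0.
  have F2two : 2%:R = 0 :> 'F_2 by exact: val_inj.
  by rewrite -mulr2n -scaler_nat F2two scale0r.
have lineI (z w : F2space v) : z != 0 -> <[z]>%VS = <[w]>%VS -> z = w.
  move=> zN0 e; have /vlineP[a za] : z \in <[w]>%VS by rewrite -e memv_line.
  by case: (F2 a) za zN0 => -> ->; rewrite ?scale0r ?scale1r ?eqxx.
have sN0 : x + y != 0.
  apply: contraNneq xyN => e; suff -> : x = y by [].
  by rewrite -[x]addr0 -(addxx y) addrA e add0r.
apply: (iffP eqP) => [-> | [pQ sQ QP QR]].
  split; first by rewrite /is_point dim_vline sN0.
  - by rewrite -memvE memv_add ?memv_line.
  - apply: contra_neq yN0 => /(lineI _ _ sN0) e.
    by apply: (addrI x); rewrite e addr0.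
  - apply: contra_neq xN0 => /(lineI _ _ sN0) e.
    by apply: (addIr y); rewrite e add0r.
have zN0: vpick Q != 0 by rewrite vpick0 -dimv_eq0 (eqP pQ).
move: (pointE pQ) sQ QP QR zN0; move: (vpick Q) => z -> + + +.
rewrite -memvE; case/memv_addP => _ /vlineP[a ->] [_ /vlineP[b ->] ->].
by case: (F2 a) (F2 b) => -> [] ->;
  rewrite ?scale0r ?scale1r ?addr0 ?add0r ?eqxx.
Qed.

End Geometry.

Arguments points v : clear implicits.
Arguments GLaction v : clear implicits.

Definition is_design2 (v k lambda2 : nat) (B : {set {vspace F2space v}}) :=
  (forall b, b \in B -> \dim b = k) /\
  (forall L : {vspace F2space v}, \dim L = 2 ->
     #|[set b in B | (L <= b)%VS]| = lambda2).

Definition automorphism_group (v : nat) (B : {set {vspace F2space v}})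
    (G : {group {'GL_v(2)}}) :=
  forall g, g \in G -> [set GLaction v b g | b in B] = B.

Definition orbit_enumeration (v : nat) (G : {group {'GL_v(2)}})
    (X : {set {vspace F2space v}}) (m : nat)
    (Xs : 'I_m -> {set {vspace F2space v}}) :=
  injective Xs /\ [set Xs i | i : 'I_m] = orbit (GLaction v) G @: X.

Definition tactical_matrices (v m n : nat)
    (Psi : 'I_m -> {set {vspace F2space v}})
    (Bs : 'I_n -> {set {vspace F2space v}}) (rho kappa : 'M[nat]_(m, n)) :=
  (forall i j P, P \in Psi i -> #|[set b in Bs j | (P <= b)%VS]| = rho i j) /\
  (forall i j b, b \in Bs j -> #|[set P in Psi i | (P <= b)%VS]| = kappa i j).

Definition sigma (v : nat) (P : {vspace F2space v})
    (Psir Psis : {set {vspace F2space v}}) : nat :=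
  #|[set R in Psir :\ P | third_point P R \in Psis]|.

Definition phi3 (v : nat) (B : {set {vspace F2space v}})
    (P : {vspace F2space v}) (Psir Psis : {set {vspace F2space v}}) : nat :=
  (\sum_(R in Psir) \sum_(S in Psis | \dim (P + R + S)%VS == 3)
     #|[set b in B | (P + R + S <= b)%VS]|)%N.

Definition lambda1 (v k lambda2 : nat) : rat :=
  lambda2%:R * (2 ^+ (v - 1) - 1) / (2 ^+ (k - 1) - 1).

(* For a < b the factor i = a vanishes, so the value is 0.                     *)
Definition gauss_binom2 (a b : nat) : rat :=
  (\prod_(i < b) (2 ^+ (a - i) - 1)) / (\prod_(i < b) (2 ^+ (b - i) - 1)).

(* There are no subspaces of dimension k - 3 < 0: the Gaussian coefficient is  *)
(* then 0.                                                                     *)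
Definition varphi (v k lambda2 : nat) : rat :=
  Num.min lambda2%:R
    (if (3 <= k)%N then gauss_binom2 (v - 3) (k - 3) else 0).

(* The hypothesis tactical_matrices is thus satisfiable for every orbit        *)
(* decomposition.                                                              *)
Lemma tactical_matrices_exist (v m n : nat) (B : {set {vspace F2space v}})
    (G : {group {'GL_v(2)}}) (Psi : 'I_m -> {set {vspace F2space v}})
    (Bs : 'I_n -> {set {vspace F2space v}}) :
  orbit_enumeration G (points v) Psi ->
  orbit_enumeration G B Bs ->
  exists rho kappa, tactical_matrices Psi Bs rho kappa.
Proof.
move=> [_ eP] [_ eB].
have orbit_stable (X : {set {vspace F2space v}}) p
    (Xs : 'I_p -> {set {vspace F2space v}}) (i : 'I_p) :
    [set Xs i | i : 'I_p] = orbit (GLaction v) G @: X ->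
  exists x, Xs i = orbit (GLaction v) G x.
  move=> e; have : Xs i \in [set Xs i | i : 'I_p] by apply: imset_f.
  by rewrite e => /imsetP[x _ ->]; exists x.
have leM (P b : {vspace F2space v}) g :
    (GLimage P g <= GLimage b g)%VS = (P <= b)%VS.
  apply/idP/idP => [le|]; last exact: limgS.
  rewrite -(GLimage1 P) -(GLimage1 b) -(mulgV g) !GLimageM; exact: limgS.
have actO x y g : g \in G ->
    (GLimage y g \in orbit (GLaction v) G x) = (y \in orbit (GLaction v) G x).
  by move=> gG; rewrite -[GLimage y g]/(GLaction v y g) orbit_actr.
have injg g : injective (fun U : {vspace F2space v} => GLimage U g).
  exact: (act_inj (GLaction v) g).
have count_inv q y g (e : rel {vspace F2space v}) : g \in G ->
    (forall P b, e (GLimage P g) (GLimage b g) = e P b) ->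
    #|[set b in orbit (GLaction v) G q | e (GLimage y g) b]| =
    #|[set b in orbit (GLaction v) G q | e y b]|.
  move=> gG eM; rewrite -(card_preimset _ (@injg g)).
  by congr #|pred_of_set _|; apply/setP => b; rewrite !inE actO // eM.
have in_orbit p x y : x \in orbit (GLaction v) G p ->
    y \in orbit (GLaction v) G p -> exists2 g, g \in G & GLimage y g = x.
  move=> xp yp; have /orbitP[g gG gyx] : x \in orbit (GLaction v) G y.
    by rewrite (orbit_eqP yp).
  by exists g.
exists (\matrix_(i, j) if [pick P in Psi i] is Some P
          then #|[set b in Bs j | (P <= b)%VS]| else 0%N).
exists (\matrix_(i, j) if [pick b in Bs j] is Some b
          then #|[set P in Psi i | (P <= b)%VS]| else 0%N).
split=> i j x xin; rewrite mxE; case: pickP => [y yin|/(_ x)]; rewrite ?xin //;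
  have [p ep] := orbit_stable _ _ _ i eP; have [q eq] := orbit_stable _ _ _ j eB.
- move: xin yin; rewrite ep eq => xin /(in_orbit _ _ _ xin)[g gG <-].
  by apply: (count_inv q y g (fun P b => (P <= b)%VS)).
- move: xin yin; rewrite ep eq => xin /(in_orbit _ _ _ xin)[g gG <-].
  by apply: (count_inv p y g (fun b P => (P <= b)%VS)).
Qed.

(* Main.v *)
Require Import Defs.
From mathcomp Require Import all_boot all_order all_algebra all_fingroup.
From mathcomp Require Import finfield ring.
Import Order.TTheory GRing.Theory Num.Theory.
Local Open Scope ring_scope.

Set Implicit Arguments.
Unset Strict Implicit.
Unset Printing Implicit Defensive.

(** Expanding each [rho l j] and [kappa i j] as a number of incidences turns
    [\sum_j rho l j * kappa r j * kappa s j] into the sum, over the pairs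
    [(R, S)] of [Psi r * Psi s], of the number of blocks through [P + R + S].
    That number is [lambda1], [lambda2] or a summand of [phi3] according to the
    dimension 1, 2 or 3 of [P + R + S]. The dimension is 1 only for
    [R = S = P], and 2 exactly when [R = P != S], [S = P != R], [R = S != P], or
    [S] is the third point of the line through [P] and [R != P], the last
    case occurring [sigma] times. All other pairs contribute to [phi3], each at
    most [varphi]: the blocks through a 3-space are among those through any of
    its lines and among all [k]-spaces containing it. *)

(** * Counting blocks and subspaces that contain a given subspace *)

Section Counting.

Variable v : nat.
Implicit Types (U W b : {vspace F2space v}) (B : {set {vspace F2space v}}).

Lemma card_F2subspace U : #|U| = (2 ^ \dim U)%N.
Proof. by rewrite card_vspace card_Fp. Qed.

Lemma dim_F2spacef : \dim {:F2space v} = v.-1.+1.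
Proof. by rewrite dimvf /dim /= mul1n. Qed.

Lemma card_subspaceD U W : (U <= W)%VS ->
  #|[set x in W | x \notin U]| = (2 ^ \dim W - 2 ^ \dim U)%N.
Proof.
move=> UW; rewrite -!card_F2subspace.
have -> : #|[set x in W | x \notin U]| = #|[predD W & U]|.
  by apply: eq_card => x; rewrite !inE andbC.
rewrite -(cardID (mem U) (mem W)).
suff -> : #|predI (mem W) (mem U)| = #|U| by rewrite addKn.
apply: eq_card => x; rewrite !inE andbC.
by case: (boolP (x \in U)) => //= /(subvP UW).
Qed.

Lemma dim_add_line U x : x \notin U -> \dim (U + <[x]>) = (\dim U).+1.
Proof.
move=> xU; have xN0: x != 0 by apply: contraNneq xU => ->; rewrite mem0v.
rewrite dimv_disjoint_sum ?dim_vline ?xN0 ?addn1 //.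
apply/eqP; rewrite -subv0; apply/subvP => y /memv_capP[yU /vlineP[a ya]].
rewrite memv0 ya; have [->|a0] := eqVneq a 0; first by rewrite scale0r.
by case/negP: xU; rewrite -(scalerK a0 x) -ya memvZ.
Qed.

(** Double counting of the pairs of a vector [x] outside [U] and a block [b] containing both [U] and
    [x]. Each block through [U] has [2 ^ k - 2 ^ \dim U] such vectors. *)
Lemma sum_card_containing_add_line B U (k : nat) :
    (forall b, b \in B -> \dim b = k) ->
  (#|[set b in B | (U <= b)%VS]| * (2 ^ k - 2 ^ \dim U)
   = \sum_(x | x \notin U) #|[set b in B | (U + <[x]> <= b)%VS]|)%N.
Proof.
move=> dimB; rewrite -sum_nat_const.
transitivity (\sum_(b in [set b in B | (U <= b)%VS])
                \sum_(x | (x \notin U) && (x \in b)) 1)%N.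
  apply: eq_bigr => b; rewrite inE => /andP[bB Ub].
  rewrite -(dimB _ bB) -card_subspaceD // -sum1_card.
  by apply: eq_bigl => x; rewrite inE andbC.
rewrite (exchange_big_dep (fun x => x \notin U)) /=;
  last by move=> ? ? _ /andP[].
apply: eq_bigr => x xU; rewrite -sum1_card.
by apply: eq_bigl => b; rewrite !inE xU subv_add -memvE /= andbA.
Qed.

Lemma expr2_subr1_neq0 n : (2 ^+ n.+1 - 1 : rat) != 0.
Proof. by rewrite subr_eq0 gt_eqF // exprn_egt1. Qed.

Lemma natr_exp2B d n : (d <= n)%N ->
  (2 ^ n - 2 ^ d)%N%:R = 2 ^+ d * (2 ^+ (n - d) - 1) :> rat.
Proof.
move=> dn; rewrite natrB ?leq_exp2l // !natrX -[in LHS](subnKC dn) exprD.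
by rewrite mulrBr mulr1.
Qed.

(** Every vector outside [U] spans with [U] a space one dimension higher, so it contributes [c] to
    the double count. This one recurrence yields both [lambda1] and the Gaussian coefficients. *)
Lemma card_containing B U k (c : rat) : (\dim U < k)%N ->
    (forall b, b \in B -> \dim b = k) ->
    (forall W, (U <= W)%VS -> \dim W = (\dim U).+1 ->
       #|[set b in B | (W <= b)%VS]|%:R = c) ->
  #|[set b in B | (U <= b)%VS]|%:R =
    c * (2 ^+ (v.-1.+1 - \dim U) - 1) / (2 ^+ (k - \dim U) - 1).
Proof.
move=> Uk dimB cW.
have Uv : (\dim U <= v.-1.+1)%N.
  by have := dimvS (subvf U); rewrite dim_F2spacef.
have k0 : 2 ^+ (k - \dim U) - 1 != 0 :> rat.
  by rewrite -(subnSK Uk) expr2_subr1_neq0.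
have d0 : 2 ^+ \dim U != 0 :> rat by rewrite expf_neq0.
(* After the denominator is cleared, the factor [2 ^+ \dim U] turns both differences into numbers of
   vectors outside [U]: those in one block and those in the whole space. *)
apply: (canRL (mulfK k0)); apply: (mulfI d0).
rewrite mulrCA -(natr_exp2B (ltnW Uk)) -natrM sum_card_containing_add_line //.
rewrite natr_sum (eq_bigr (fun=> c)) => [|x xU]; last first.
  by rewrite cW ?addvSl ?dim_add_line.
rewrite sumr_const -[LHS]mulr_natr mulrCA -natr_exp2B //.
have := card_subspaceD (subvf U); rewrite dim_F2spacef => <-; congr (_ * _%:R).
by apply: eq_card => x; rewrite !inE memvf.
Qed.

Lemma gauss_binom2_0 a : gauss_binom2 a 0 = 1.
Proof. by rewrite /gauss_binom2 !big_ord0 divr1. Qed.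

(** Peeling the leading factor off numerator and denominator gives the recurrence of
    [card_containing]. *)
Lemma gauss_binom2S a n :
  gauss_binom2 a n.+1 =
    gauss_binom2 a.-1 n * (2 ^+ a - 1) / (2 ^+ n.+1 - 1).
Proof.
rewrite /gauss_binom2 !big_ord_recl !subn0 invfM.
under eq_bigr do rewrite lift0 subnS -subn1 subnAC subn1.
under [X in _ / X]eq_bigr do rewrite lift0 subSS.
by rewrite [in LHS]mulrACA -[RHS]mulrA [RHS]mulrC; congr (_ * (_ / _)).
Qed.

(** Induction on the codimension [k - \dim U], applying [card_containing] to the family of all
    [k]-dimensional subspaces. *)
Lemma card_subspaces_containing U k : (\dim U <= k)%N ->
  #|[set b : {vspace F2space v} | (\dim b == k) && (U <= b)%VS]|%:R =
  gauss_binom2 (v.-1.+1 - \dim U) (k - \dim U).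
Proof.
move e: (k - \dim U)%N => d; elim: d U e => [|d IHd] U e Uk.
  have <- : \dim U = k by apply/eqP; rewrite eqn_leq Uk -subn_eq0 e.
  rewrite gauss_binom2_0.
  suff -> : [set b | (\dim b == \dim U) && (U <= b)%VS] = [set U].
    by rewrite cards1.
  apply/setP => b; rewrite !inE.
  apply/andP/eqP => [[db Ub]|->]; last by rewrite eqxx.
  by apply/esym/eqP; rewrite eqEdim Ub (eqP db) leqnn.
have Uk' : (\dim U < k)%N by rewrite -subn_gt0 e.
have SE W : [set b | (\dim b == k) && (W <= b)%VS]
          = [set b in [set b | \dim b == k] | (W <= b)%VS].
  by apply/setP => b; rewrite !inE.
rewrite SE gauss_binom2S.
rewrite (card_containing (c := gauss_binom2 (v.-1.+1 - \dim U).-1 d) Uk') ?e //.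
  by move=> b; rewrite inE => /eqP.
by move=> W _ dW; rewrite -SE IHd ?dW // ?subnS ?e.
Qed.

End Counting.

(** * Classifying pairs of points by the dimension they span with [P] *)

Section PointTriples.

Variable v : nat.
Implicit Types (U W b P R S T : {vspace F2space v}).
Implicit Types (B X Y : {set {vspace F2space v}}).

Lemma dim_add_point U R : is_point R ->
  \dim (U + R) = (~~ (R <= U)%VS + \dim U)%N.
Proof.
move=> pR; have [/addv_idPl->//|] := boolP (R <= U)%VS.
by rewrite {1 2}(pointE pR) -memvE => /dim_add_line ->.
Qed.

Lemma sub_point P R : is_point P -> is_point R -> (R <= P)%VS = (R == P).
Proof.
by move=> pP pR; rewrite eqEdim (eqP pP) (eqP pR) leqnn andbT.
Qed.

Lemma third_point_neq P R : is_point P -> is_point R -> R != P ->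
  third_point P R != P /\ third_point P R != R.
Proof.
move=> pP pR; rewrite eq_sym => PR.
by have [] := elimT (third_pointP (third_point P R) pP pR PR) (eqxx _).
Qed.

Lemma sub_add_points P R S : is_point P -> is_point R -> is_point S -> R != P ->
  (S <= P + R)%VS = [|| S == P, S == R | S == third_point P R].
Proof.
move=> pP pR pS; rewrite eq_sym => PR.
have [->|SP] := eqVneq S P.
    by rewrite addvSl.
have [->|SR] /= := eqVneq S R; first by rewrite addvSr.
by apply/idP/(third_pointP S pP pR PR) => [SPR|[]].
Qed.

Lemma dim_triple_eq P S : is_point P -> is_point S ->
  \dim (P + P + S) = (S != P).+1.
Proof.
move=> pP pS; rewrite addvv dim_add_point // sub_point //.
by rewrite (eqP pP) addn1.
Qed.

Lemma dim_triple_neq P R S : is_point P -> is_point R -> is_point S -> R != P ->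
  \dim (P + R + S) = (3 - [|| S == P, S == R | S == third_point P R])%N.
Proof.
move=> pP pR pS RP; rewrite !dim_add_point // sub_add_points // sub_point //.
by rewrite (eqP pP) RP; case: (_ || _).
Qed.

Lemma dim_triple_range P R S : is_point P -> is_point R -> is_point S ->
  \dim (P + R + S) \in [:: 1; 2; 3].
Proof.
move=> pP pR pS; have [->|RP] := eqVneq R P.
  by rewrite dim_triple_eq //; case: (_ != _).
by rewrite dim_triple_neq //; case: (_ || _).
Qed.

(** A double sum of 0/1 indicators, so that these counts and [phi3] can be compared summand by
    summand. *)
Definition pairs_of_dim P X Y d : nat :=
  (\sum_(R in X) \sum_(S in Y) (\dim (P + R + S) == d :> nat))%N.

(** Read from right to left, it spreads a membership term over [A], so that identities between
    counts reduce to single summands. *)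
Lemma sum_eq_mem (T : finType) (A : {set T}) (x : T) (c : nat) :
  (\sum_(y in A) (y == x) * c = (x \in A) * c)%N.
Proof.
rewrite -big_distrl /=; congr (_ * _)%N; case: (boolP (x \in A)) => xA.
  by rewrite (bigD1 x) //= eqxx big1 // => y /andP[_ /negPf->].
by apply: big1 => y yA; case: eqP xA yA => // -> /negPf->.
Qed.

Lemma sum_bool_card (T : finType) (A : {set T}) (p : pred T) :
  (\sum_(y in A) p y = #|[set y in A | p y]|)%N.
Proof.
by rewrite -sum1_card big_mkcond [RHS]big_mkcond; apply: eq_bigr => y _;
  rewrite !inE; case: (_ \in _); case: (p y).
Qed.

Section Pairs.

Variables (P : {vspace F2space v}) (X Y : {set {vspace F2space v}}).
Hypothesis pP : is_point P.
Hypotheses (Xpt : X \subset points v) (Ypt : Y \subset points v).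

Let pX R : R \in X -> is_point R.
Proof. by move/(subsetP Xpt); rewrite inE. Qed.

Let pY R : R \in Y -> is_point R.
Proof. by move/(subsetP Ypt); rewrite inE. Qed.

Lemma pairs_of_dim1 : pairs_of_dim P X Y 1 = ((P \in X) * (P \in Y))%N.
Proof.
rewrite -[in RHS]sum_eq_mem; apply: eq_bigr => R /pX pR.
have [->|RP] := eqVneq R P.
  rewrite mul1n -[RHS]muln1 -sum_eq_mem; apply: eq_bigr => S /pY pS.
  by rewrite dim_triple_eq // muln1; case: (S == P).
rewrite mul0n; apply: big1 => S /pY pS.
by rewrite dim_triple_neq //; case: (_ || _).
Qed.

(** For [R = P] any [S != P] spans a line with [P]. For [R != P] the point [S] must be one of the
    three points of the line through [P] and [R], which gives the other three terms. *)
Lemma pairs_of_dim2 : pairs_of_dim P X Y 2 =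
  ((P \in X) * #|Y :\ P| + (P \in Y) * #|X :\ P| + #|(X :&: Y) :\ P|
   + sigma P X Y)%N.
Proof.
have inner R : R \in X -> (\sum_(S in Y) (\dim (P + R + S) == 2 :> nat) =
    (R == P) * #|Y :\ P| + (R != P) * (P \in Y) + ((R != P) && (R \in Y))
    + ((R != P) && (third_point P R \in Y)))%N.
  move=> /pX pR; have [->|RP] /= := eqVneq R P.
    rewrite !addn0 mul1n -sum1_card big_mkcond [RHS]big_mkcond /=.
    apply: eq_bigr => S _; rewrite !inE andbC; case: ifP => // /pY pS.
    by rewrite dim_triple_eq //; case: (S == P).
  have [TP TR] := third_point_neq pP pR RP.
  (* The three membership terms become sums over [Y] of the indicators of [S == P], [S == R] and
     [S == third_point P R]. These points are distinct, so at most one indicator is 1. *)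
  rewrite mul0n mul1n add0n -[X in (X + _ + _)%N]muln1.
  rewrite -[X in (_ + X + _)%N]muln1 -[X in (_ + X)%N]muln1 -!sum_eq_mem -!big_split /=.
  apply: eq_bigr => S /pY pS; rewrite dim_triple_neq // !muln1.
  have [->|SP] := eqVneq S P.
    by rewrite ![P == _]eq_sym (negPf RP) (negPf TP).
  have [->|SR] := eqVneq S R.
    by rewrite ![R == _]eq_sym (negPf TR).
  by case: (S == _).
rewrite /pairs_of_dim (eq_bigr _ inner) !big_split /=; congr (_ + _ + _ + _)%N.
- exact: sum_eq_mem.
- rewrite -big_distrl /= mulnC sum_bool_card; congr (_ * _)%N.
  by apply: eq_card => R; rewrite !inE andbC.
- by rewrite sum_bool_card; apply: eq_card => R; rewrite !inE andbCA.
- rewrite sum_bool_card; apply: eq_card => R; rewrite !inE.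
  by rewrite andbCA andbA.
Qed.

Lemma sum_pairs_of_dim :
  (pairs_of_dim P X Y 1 + pairs_of_dim P X Y 2 + pairs_of_dim P X Y 3
   = #|X| * #|Y|)%N.
Proof.
rewrite -sum_nat_const -!big_split; apply: eq_bigr => R /pX pR /=.
rewrite -!big_split -sum1_card; apply: eq_bigr => S /pY pS /=.
by have := dim_triple_range pP pR pS; rewrite !inE => /or3P[] /eqP->.
Qed.

Lemma sum_card_containing_triple B lambda2 :
    (forall L : {vspace F2space v}, \dim L = 2 ->
       #|[set b in B | (L <= b)%VS]| = lambda2) ->
  (\sum_(R in X) \sum_(S in Y) #|[set b in B | (P + R + S <= b)%VS]| =
   pairs_of_dim P X Y 1 * #|[set b in B | (P <= b)%VS]|
   + pairs_of_dim P X Y 2 * lambda2 + phi3 B P X Y)%N.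
Proof.
move=> B2; rewrite /pairs_of_dim !big_distrl -!big_split.
apply: eq_bigr => R /pX pR /=; rewrite !big_distrl [\sum_(S in Y | _) _]big_mkcondr -!big_split.
apply: eq_bigr => S /pY pS /=.
have := dim_triple_range pP pR pS; rewrite !inE => /or3P[] /eqP d; rewrite d /=.
- suff -> : (P + R + S)%VS = P by rewrite mul1n !addn0.
  by apply/esym/eqP; rewrite eqEdim d (eqP pP) -addvA addvSl.
- by rewrite B2 // mul1n addn0.
- by rewrite !mul0n.
Qed.

Lemma phi3_le B (c : rat) :
    (forall W, \dim W = 3 -> #|[set b in B | (W <= b)%VS]|%:R <= c) ->
  (phi3 B P X Y)%:R <= (pairs_of_dim P X Y 3)%:R * c.
Proof.
move=> B3; rewrite !natr_sum mulr_suml; apply: ler_sum => R _.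
rewrite !natr_sum mulr_suml big_mkcondr; apply: ler_sum => S _ /=.
by case: eqP => [/B3|_]; rewrite ?mul1r ?mul0r.
Qed.

End Pairs.

End PointTriples.

(** * Blocks of the design through a point or a 3-space *)

Section Design.

Variables (v k lambda2 : nat) (B : {set {vspace F2space v}}).
Hypotheses (v_gt0 : (0 < v)%N) (designB : is_design2 k lambda2 B).
Implicit Types (P W : {vspace F2space v}).

Lemma card_blocks_point P : (2 <= k)%N -> is_point P ->
  #|[set b in B | (P <= b)%VS]|%:R = lambda1 v k lambda2.
Proof.
move=> k2 /eqP dP; have [Bk B2] := designB.
rewrite (card_containing (c := lambda2%:R) _ Bk) ?dP ?prednK // => W _ dW.
by rewrite B2.
Qed.

Lemma card_blocks_dim3_le W : \dim W = 3 ->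
  #|[set b in B | (W <= b)%VS]|%:R <= varphi v k lambda2.
Proof.
move=> dW; have [Bk B2] := designB; rewrite /varphi le_min; apply/andP; split.
  (* The first two vectors of a basis of [W] span a line, and the blocks through [W] are among the
     [lambda2] blocks through it. *)
  have [R RW dR] : exists2 R : {vspace F2space v}, (R <= W)%VS & \dim R = 2.
    have : free (vbasis W) := basis_free (vbasisP W).
    have : (<<vbasis W>> = W)%VS := span_basis (vbasisP W).
    have : size (vbasis W) = 3%N by rewrite size_tuple dW.
    case: (tval (vbasis W)) => [|x [|y [|z []]]] //= _ <-.
    rewrite -[x :: _]/([:: x; y] ++ [:: z]) => /catl_free/eqP dxy.
    by exists <<[:: x; y]>>%VS; rewrite // span_cat addvSl.
  rewrite -(B2 R dR) ler_nat subset_leq_card //; apply/subsetP => b.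
  by rewrite !inE => /andP[-> /(subv_trans RW)].
case: ifP => k3; last first.
  (* For [k < 3] no block can contain a 3-space, in agreement with the value 0 used in [varphi]. *)
  rewrite -[0]/(0%:R) ler_nat leqn0 cards_eq0.
  apply/eqP/setP => b; rewrite !inE.
  by apply/negP => /andP[/Bk dB /dimvS]; rewrite dW dB k3.
have -> : (v - 3 = v.-1.+1 - 3)%N by rewrite prednK.
have := @card_subspaces_containing v W k; rewrite dW => <- //.
rewrite ler_nat subset_leq_card //; apply/subsetP => b.
by rewrite !inE => /andP[/Bk-> ->]; rewrite eqxx.
Qed.

End Design.

(** * Linear images, orbits, and invariance of [sigma] *)

Section Orbits.

Variables (v : nat) (G : {group {'GL_v(2)}}).
Implicit Types (P R U W : {vspace F2space v}).
Implicit Types (X Y : {set {vspace F2space v}}).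

Lemma subv_GLimage U W g : (GLimage U g <= GLimage W g)%VS = (U <= W)%VS.
Proof.
apply/idP/idP => [le|]; last exact: limgS.
rewrite -(GLimage1 U) -(GLimage1 W) -(mulgV g) !GLimageM; exact: limgS.
Qed.

Lemma GLimage_eq U W g : (GLimage U g == GLimage W g) = (U == W).
Proof. by rewrite !eqEsubv !subv_GLimage. Qed.

Lemma dim_GLimage U g : \dim (GLimage U g) = \dim U.
Proof.
have le W h : (\dim (GLimage W h) <= \dim W)%N.
  by rewrite -(limg_ker_dim (linfun (mulmxr (GLval h))) W) leq_addl.
(* The reverse inequality is [le] for the inverse of [g], applied to the image of [U]. *)
apply/eqP; rewrite eqn_leq le -{1}(GLimage1 U) -(mulgV g) GLimageM; exact: le.
Qed.

(** [third_pointP] characterises the third point by dimension and incidence alone, and [g] preserves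
    both; no computation with [vpick] is needed. *)
Lemma third_point_GLimage P R g : is_point P -> is_point R -> R != P ->
  third_point (GLimage P g) (GLimage R g) = GLimage (third_point P R) g.
Proof.
have pg U : is_point (GLimage U g) = is_point U.
  by rewrite /is_point dim_GLimage.
move=> pP pR; rewrite eq_sym => PR; apply/esym/eqP.
apply/third_pointP; rewrite ?pg ?GLimage_eq //.
have [pT sT TP TR] := elimT (third_pointP (third_point P R) pP pR PR) (eqxx _).
by rewrite -limgD subv_GLimage.
Qed.

(** The action of [g] is a bijection from the points counted for [P] to those counted for its image.
    Hence [sigma] does not depend on the point chosen in an orbit. *)
Lemma sigma_GLimage P X Y g : is_point P -> X \subset points v ->
    (forall U, (GLimage U g \in X) = (U \in X)) ->
    (forall U, (GLimage U g \in Y) = (U \in Y)) ->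
  sigma (GLimage P g) X Y = sigma P X Y.
Proof.
move=> pP Xpt Xg Yg; rewrite /sigma -(card_preimset _ (act_inj (GLaction v) g)).
apply: eq_card => R; rewrite !inE /= GLimage_eq Xg.
have [->|RP] //= := eqVneq R P; case: (boolP (R \in X)) => //= RX.
rewrite third_point_GLimage ?Yg //.
by move/(subsetP Xpt): RX; rewrite inE.
Qed.

Variables (X : {set {vspace F2space v}}) (m : nat).
Variable (Xs : 'I_m -> {set {vspace F2space v}}).
Hypotheses (orbX : orbit_enumeration G X Xs).

Lemma orbit_enumE i U : U \in Xs i -> Xs i = orbit (GLaction v) G U.
Proof.
move=> Ui; have : Xs i \in [set Xs i | i : 'I_m] by apply: imset_f.
rewrite orbX.2 => /imsetP[W _ e]; rewrite e in Ui *.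
exact/esym/orbit_eqP.
Qed.

Lemma orbit_enum_GLimage i U g : g \in G ->
  (GLimage U g \in Xs i) = (U \in Xs i).
Proof.
move=> gG; have : Xs i \in [set Xs i | i : 'I_m] by apply: imset_f.
rewrite orbX.2 => /imsetP[W _ ->].
by rewrite -[GLimage U g]/(GLaction v U g) orbit_actr.
Qed.

Lemma orbit_enum_inj i j U : U \in Xs i -> U \in Xs j -> i = j.
Proof.
by move=> Ui Uj; apply: orbX.1; rewrite (orbit_enumE Ui) (orbit_enumE Uj).
Qed.

(** The enumerated orbits partition the stable set [X]: each lies in [X], each element lies in its
    own orbit, and no two of them share an element. *)
Lemma sum_orbit_enum (F : {vspace F2space v} -> nat) :
    (forall U g, U \in X -> g \in G -> GLimage U g \in X) ->
  (\sum_(j < m) \sum_(U in Xs j) F U = \sum_(U in X) F U)%N.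
Proof.
move=> Xg; have XsX j : Xs j \subset X.
  have : Xs j \in [set Xs i | i : 'I_m] by apply: imset_f.
  rewrite orbX.2 => /imsetP[W WX ->]; apply/subsetP => _ /orbitP[g gG <-].
  exact: Xg.
rewrite (exchange_big_dep (mem X)) /=; last by move=> j U _ /(subsetP (XsX j)).
apply: eq_bigr => U UX.
have : orbit (GLaction v) G U \in [set Xs i | i : 'I_m].
  by rewrite orbX.2 imset_f.
case/imsetP => j _ e; have Uj : U \in Xs j by rewrite -e orbit_refl.
rewrite (bigD1 j) //= big1 ?addn0 // => i /andP[Ui].
by rewrite (orbit_enum_inj Ui Uj) eqxx.
Qed.

End Orbits.

Lemma orbit_enum_points v (G : {group {'GL_v(2)}}) m
    (Psi : 'I_m -> {set {vspace F2space v}}) i :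
  orbit_enumeration G (points v) Psi -> Psi i \subset points v.
Proof.
case=> _ e; have : Psi i \in [set Psi i | i : 'I_m] by apply: imset_f.
rewrite e => /imsetP[P Ppt ->]; apply/subsetP => _ /orbitP[g _ <-].
by move: Ppt; rewrite !inE /is_point /= dim_GLimage.
Qed.

(** * The matrix sum as a count of incidences, and the final case analysis *)

Lemma tactical_triple_sum v (B : {set {vspace F2space v}})
    (G : {group {'GL_v(2)}}) m n (Psi : 'I_m -> {set {vspace F2space v}})
    (Bs : 'I_n -> {set {vspace F2space v}}) (rho kappa : 'M[nat]_(m, n))
    (l r s : 'I_m) P :
    automorphism_group B G -> orbit_enumeration G B Bs ->
    tactical_matrices Psi Bs rho kappa -> P \in Psi l ->
  (\sum_(j < n) rho l j * kappa r j * kappa s j =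
   \sum_(R in Psi r) \sum_(S in Psi s) #|[set b in B | (P + R + S <= b)%VS]|)%N.
Proof.
move=> autG orbB [rhoE kappaE] Pl.
(* [rho l j] counts the blocks of [Bs j] through [P], and each block of [Bs j] has the same
   [kappa r j] and [kappa s j], so the product can be distributed over single blocks. *)
transitivity (\sum_(j < n) \sum_(b in Bs j) (P <= b)%VS *
   (\sum_(R in Psi r) (R <= b)%VS) * (\sum_(S in Psi s) (S <= b)%VS))%N.
  apply: eq_bigr => j _; rewrite -(rhoE _ j _ Pl) -sum_bool_card !big_distrl /=.
  by apply: eq_bigr => b bj; rewrite -!(kappaE _ _ _ bj) !sum_bool_card.
rewrite (sum_orbit_enum orbB); last first.
  by move=> b g bB gG; rewrite -(autG _ gG); apply/imsetP; exists b.
under eq_bigr do rewrite -mulnA big_distrlr big_distrr /=.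
rewrite exchange_big; apply: eq_bigr => R _ /=.
under eq_bigr do rewrite big_distrr /=.
rewrite exchange_big; apply: eq_bigr => S _ /=.
rewrite -sum_bool_card; apply: eq_bigr => b _.
by rewrite !subv_add !mulnb andbA.
Qed.

Theorem mainTheorem4 (v k lambda2 : nat) (v_gt0 : (0 < v)%N)
    (k_ge2 : (2 <= k)%N)
    (B : {set {vspace F2space v}}) (G : {group {'GL_v(2)}})
    (designB : is_design2 k lambda2 B) (autG : automorphism_group B G)
    (m n : nat) (Psi : 'I_m -> {set {vspace F2space v}})
    (Bs : 'I_n -> {set {vspace F2space v}})
    (orbPsi : orbit_enumeration G (points v) Psi)
    (orbB : orbit_enumeration G B Bs)
    (rho kappa : 'M[nat]_(m, n))
    (tdm : tactical_matrices Psi Bs rho kappa)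
    (l r s : 'I_m) (P : {vspace F2space v}) (Pl : P \in Psi l) :
  let sig : rat := (sigma P (Psi r) (Psi s))%:R in
  let phi : rat := (phi3 B P (Psi r) (Psi s))%:R in
  let lhs : rat := (\sum_(j < n) rho l j * kappa r j * kappa s j)%N%:R in
  let L2 : rat := lambda2%:R in
  let L1 : rat := lambda1 v k lambda2 in
  let vphi : rat := varphi v k lambda2 in
  let card (i : 'I_m) : rat := #|Psi i|%:R in
  [/\ forall Q, Q \in Psi l ->
        sigma Q (Psi r) (Psi s) = sigma P (Psi r) (Psi s),
      [/\ l != r -> r != s -> s != l -> lhs = sig * L2 + phi,
          l = r -> r = s ->
            lhs = L1 + (3 * card l + sig - 3) * L2 + phi
        & (l = r /\ r != s) \/ (l != r /\ r = s) ->
            lhs = (card s + sig) * L2 + phi]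
    & [/\ l != r -> r != s -> s != l ->
            phi <= (card r * card s - sig) * vphi,
          l = r -> r = s ->
            phi <= (card l ^+ 2 - 3 * card l - sig + 2) * vphi
        & (l = r /\ r != s) \/ (l != r /\ r = s) ->
            phi <= (card r * card s - card s - sig) * vphi]].
Proof.
move=> sig phi lhs L2 L1 vphi card.
have pts i : Psi i \subset points v := orbit_enum_points i orbPsi.
have pP : is_point P by move/(subsetP (pts l)): Pl; rewrite inE.
have mem_Psi i : (P \in Psi i) = (l == i).
  by apply/idP/eqP => [/(orbit_enum_inj orbPsi Pl)|<-].
have lhsE : lhs = (pairs_of_dim P (Psi r) (Psi s) 1)%:R * L1
                  + (pairs_of_dim P (Psi r) (Psi s) 2)%:R * L2 + phi.
  rewrite /lhs (tactical_triple_sum r s autG orbB tdm Pl).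
  rewrite (sum_card_containing_triple pP (pts r) (pts s) designB.2).
  by rewrite !natrD !natrM (card_blocks_point v_gt0 designB).
have phi_le c : (pairs_of_dim P (Psi r) (Psi s) 3)%:R = c -> phi <= c * vphi.
  by move=> <-; apply: phi3_le => W; apply: card_blocks_dim3_le.
(* The bounds come from complementary counting: the pairs of dimension 3 are all pairs minus those
   of dimensions 1 and 2. *)
have D3E : (pairs_of_dim P (Psi r) (Psi s) 3)%:R = card r * card s
    - (pairs_of_dim P (Psi r) (Psi s) 1)%:R
    - (pairs_of_dim P (Psi r) (Psi s) 2)%:R :> rat.
  by rewrite -natrM -(sum_pairs_of_dim pP (pts r) (pts s)) !natrD /=; ring.
have cardD1 : #|Psi l :\ P|%:R = card l - 1.
  by rewrite /card (cardsD1 P (Psi l)) Pl natrD /=; ring.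
have disjD i j : i != j -> (Psi i :&: Psi j) :\ P = set0.
  move=> ij; apply/setP => R; rewrite !inE; apply/negP => /and3P[_ Ri Rj].
  by rewrite (orbit_enum_inj orbPsi Ri Rj) eqxx in ij.
have cardN i : l != i -> #|Psi i :\ P|%:R = card i.
  move=> li; rewrite /card (cardsD1 P (Psi i)) mem_Psi.
  by rewrite (negPf li).
move: lhsE D3E; rewrite pairs_of_dim1 // pairs_of_dim2 // !mem_Psi.
rewrite !natrD !natrM -/sig => lhsE D3E; split.
- move=> Q; rewrite (orbit_enumE orbPsi Pl) => /orbitP[g gG <-].
  by apply: sigma_GLimage => // U; apply: (orbit_enum_GLimage orbPsi).
(* Since [P] lies in [Psi l] only, distinct indices leave just [sig] pairs of dimension 2. For equal
   indices there is one pair of dimension 1 and [3 * (card l - 1) + sig] of dimension 2. In the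
   mixed cases there are [card s + sig] of dimension 2 and none of dimension 1. *)
- split=> [lr rs sl|lr rs|[] [lr rs]]; rewrite lhsE.
  + by rewrite disjD // cards0 (negPf lr) [l == s]eq_sym (negPf sl) /=; ring.
  + by rewrite -rs -lr setIid eqxx cardD1 /=; ring.
  + by rewrite disjD // cards0 lr eqxx (negPf rs) cardN ?lr //=; ring.
  + by rewrite -rs setIid (negPf lr) cardN //=; ring.
- split=> [lr rs sl|lr rs|[] [lr rs]]; apply: phi_le; rewrite D3E.
  + by rewrite disjD // cards0 (negPf lr) [l == s]eq_sym (negPf sl) /=; ring.
  + by rewrite -rs -lr setIid eqxx cardD1 /=; ring.
  + by rewrite disjD // cards0 lr eqxx (negPf rs) cardN ?lr //=; ring.
  + by rewrite -rs setIid (negPf lr) cardN //=; ring.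
Qed.
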